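(* Given positive integers $m, n$ with $m > 1$, a fractional assignment $x \in [0,1]^{m \times n}$ and weights $d \in \mathbb{R}^n_{>0}$, there is a linear-time algorithm that computes an assignment $y \in \{0,1\}^{m \times n}$ such that for every $i\in[m]$ and $t\in [n]$, \[ \Big|\sum_{j \in [t]} d_j (x_{ij} - y_{ij}) \Big| \le \Big(1-\frac{1}{2m-2}\Big) \cdot \max_{j \in [n]} d_j. \]
   Context: $[k] := \{1,\dots,k\}$. A matrix $x \in [0,1]^{m \times n}$ is a fractional assignment if $\sum_{i \in [m]} x_{ij} = 1$ for every column $j \in [n]$. A matrix $y \in \{0,1\}^{m \times n}$ is an (integral) assignment if $\sum_{i \in [m]} y_{ij} = 1$ for every $j \in [n]$. Linear time means linear in the input size, i.e. $O(mn)$ elementary operations (arithmetic operations and comparisons on the input numbers). *)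

(* Defs.v *)
From mathcomp Require Import all_boot all_order all_algebra.
From mathcomp Require Import reals.
Set Implicit Arguments.
Unset Strict Implicit.
Unset Printing Implicit Defensive.
Import Order.TTheory GRing.Theory Num.Theory.
Local Open Scope ring_scope.

Definition fractional_assignment (R : realType) (m n : nat)
    (x : 'M[R]_(m, n)) : Prop :=
  (forall i j, 0 <= x i j <= 1) /\ (forall j, \sum_i x i j = 1).

Definition assignment (R : realType) (m n : nat) (y : 'M[R]_(m, n)) : Prop :=
  (forall i j, y i j = 0 \/ y i j = 1) /\ (forall j, \sum_i y i j = 1).

Definition max_weight (R : realType) (n : nat) (d : 'rV[R]_n) : R :=
  \big[Num.max/0]_(j < n) d 0 j.

(* The computation model is a real RAM, presented as a while-language.  There
   are two memories, one of natural numbers (used for indices and counters) and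
   one of real numbers.  Each is a family of two-dimensional arrays, so that
   [a, i, j] addresses the cell (i, j) of the array named a, and a scalar
   variable is a cell with constant indices.  Every memory access, arithmetic
   operation, comparison, constant, connective, assignment and branching has
   unit cost.  Real numbers cannot be rounded or otherwise converted to natural
   numbers; they influence the control flow only through comparisons. *)

Inductive iexp : Type :=
  | IConst of nat
  | IGet of nat & iexp & iexp
  | IAdd of iexp & iexp
  | ISub of iexp & iexp.

Inductive rexp : Type :=
  | RZero
  | ROne
  | RGet of nat & iexp & iexp
  | RAdd of rexp & rexp
  | RSub of rexp & rexp
  | RMul of rexp & rexp
  | RDiv of rexp & rexp.

Inductive bexp : Type :=
  | BLtI of iexp & iexp
  | BLtR of rexp & rexp
  | BNot of bexp
  | BAnd of bexp & bexp.

(* A program contains no real constants except 0 and 1, hence the syntax does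
   not depend on the type of real numbers. *)
Inductive cmd : Type :=
  | Skip
  | SetI of nat & iexp & iexp & iexp
  | SetR of nat & iexp & iexp & rexp
  | Seq of cmd & cmd
  | If of bexp & cmd & cmd
  | While of bexp & cmd.

Record store (R : realType) : Type := Store {
  imem : nat -> nat -> nat -> nat;
  rmem : nat -> nat -> nat -> R }.

Definition upd (T : Type) (f : nat -> nat -> nat -> T) (a i j : nat) (v : T) :
    nat -> nat -> nat -> T :=
  fun a' i' j' => if [&& a' == a, i' == i & j' == j] then v else f a' i' j'.

Definition set_imem (R : realType) (s : store R) (a i j v : nat) : store R :=
  Store (upd (imem s) a i j v) (rmem s).

Definition set_rmem (R : realType) (s : store R) (a i j : nat) (v : R) :
    store R :=
  Store (imem s) (upd (rmem s) a i j v).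

(* Subtraction of natural numbers is truncated. *)
Fixpoint ieval (R : realType) (s : store R) (e : iexp) : nat :=
  match e with
  | IConst k => k
  | IGet a i j => imem s a (ieval s i) (ieval s j)
  | IAdd e1 e2 => (ieval s e1 + ieval s e2)%N
  | ISub e1 e2 => (ieval s e1 - ieval s e2)%N
  end.

(* Division by zero yields zero. *)
Fixpoint reval (R : realType) (s : store R) (e : rexp) : R :=
  match e with
  | RZero => 0
  | ROne => 1
  | RGet a i j => rmem s a (ieval s i) (ieval s j)
  | RAdd e1 e2 => reval s e1 + reval s e2
  | RSub e1 e2 => reval s e1 - reval s e2
  | RMul e1 e2 => reval s e1 * reval s e2
  | RDiv e1 e2 => reval s e1 / reval s e2
  end.

Fixpoint beval (R : realType) (s : store R) (b : bexp) : bool :=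
  match b with
  | BLtI e1 e2 => (ieval s e1 < ieval s e2)%N
  | BLtR e1 e2 => reval s e1 < reval s e2
  | BNot b1 => ~~ beval s b1
  | BAnd b1 b2 => beval s b1 && beval s b2
  end.

Fixpoint icost (e : iexp) : nat :=
  match e with
  | IConst _ => 1%N
  | IGet _ e1 e2 | IAdd e1 e2 | ISub e1 e2 => (icost e1 + icost e2)%N.+1
  end.

Fixpoint rcost (e : rexp) : nat :=
  match e with
  | RZero | ROne => 1%N
  | RGet _ i j => (icost i + icost j)%N.+1
  | RAdd e1 e2 | RSub e1 e2 | RMul e1 e2 | RDiv e1 e2 =>
      (rcost e1 + rcost e2)%N.+1
  end.

Fixpoint bcost (b : bexp) : nat :=
  match b with
  | BLtI e1 e2 => (icost e1 + icost e2)%N.+1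
  | BLtR e1 e2 => (rcost e1 + rcost e2)%N.+1
  | BNot b1 => (bcost b1).+1
  | BAnd b1 b2 => (bcost b1 + bcost b2)%N.+1
  end.

(* [exec p s s' k]: started in s, the program p halts in s' after performing k
   elementary operations. *)
Inductive exec (R : realType) : cmd -> store R -> store R -> nat -> Prop :=
  | ExecSkip s : exec Skip s s 1%N
  | ExecSetI s a i j e :
      exec (SetI a i j e) s
        (set_imem s a (ieval s i) (ieval s j) (ieval s e))
        (icost i + icost j + icost e)%N.+1
  | ExecSetR s a i j e :
      exec (SetR a i j e) s
        (set_rmem s a (ieval s i) (ieval s j) (reval s e))
        (icost i + icost j + rcost e)%N.+1
  | ExecSeq s s1 s2 p q k l :
      exec p s s1 k -> exec q s1 s2 l -> exec (Seq p q) s s2 (k + l)%N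
  | ExecIf s s1 b p q k :
      exec (if beval s b then p else q) s s1 k ->
      exec (If b p q) s s1 (bcost b + k)%N.+1
  | ExecWhileDone s b p :
      ~~ beval s b -> exec (While b p) s s (bcost b).+1
  | ExecWhileStep s s1 s2 b p k l :
      beval s b -> exec p s s1 k -> exec (While b p) s1 s2 l ->
      exec (While b p) s s2 (bcost b + k + l)%N.+1.

Lemma exec_deterministic (R : realType) p (s s1 s2 : store R) k l :
  exec p s s1 k -> exec p s s2 l -> s1 = s2 /\ k = l.
Proof.
move=> H; elim: H s2 l => {p s s1 k}
  [s|s a i j e|s a i j e|s s1 s2 p q k l _ IHp _ IHq|s s1 b p q k _ IH
  |s b p Hb|s s1 s2 b p k l Hb _ IHp _ IHw] s' l' H';
  inversion H' as [| | |? ? ? ? ? ? ? Ep Eq|? ? ? ? ? ? Ei|? ? ? Nb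
                  |? ? ? ? ? ? ? Tb Ep Ew]; subst => //.
- by have [? ?] := IHp _ _ Ep; subst; have [-> ->] := IHq _ _ Eq.
- by have [-> ->] := IH _ _ Ei.
- by rewrite Tb in Hb.
- by rewrite Hb in Nb.
- by have [? ?] := IHp _ _ Ep; subst; have [-> ->] := IHw _ _ Ew.
Qed.

Definition entry (R : realType) (m n : nat) (A : 'M[R]_(m, n)) (i j : nat) : R :=
  if (insub i, insub j) is (Some i', Some j') then A i' j' else 0.

(* Input: m and n are the cells (0, 0) and (0, 1) of the natural-number array 0;
   x is the real array 0, and d is row 0 of the real array 1.  All other cells
   are 0. *)
Definition input_store (R : realType) (m n : nat) (x : 'M[R]_(m, n))
    (d : 'rV[R]_n) : store R :=
  Store
    (upd (upd (fun _ _ _ => 0%N) 0%N 0%N 0%N m) 0%N 0%N 1%N n)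
    (fun a i j =>
       match a with
       | 0%N => entry x i j
       | 1%N => entry d i j
       | _ => 0
       end).

(* Output: the top-left m x n block of the real array 2. *)
Definition output (R : realType) (m n : nat) (s : store R) : 'M[R]_(m, n) :=
  \matrix_(i < m, j < n) rmem s 2%N i j.

(* Main.v *)
(* Write F_i(t) for the sum of d_k x_ik and L_i(t) for the sum of d_k y_ik over
   k <= t, D for the maximal weight, eps = D / (2m - 2) and delta = D - eps.  As
   in Tijdeman's solution of the chairman assignment problem, job j goes to the
   machine with the earliest deadline among those that may receive it, i.e. with
   F_i(j) - L_i(j-1) >= d_j - delta; the deadline of i is the least T such that
   F_i(T) - L_i(j-1) > delta.
   Suppose that F_i(T) - L_i(T) > delta for some i, and let s <= T be the last
   job given to a machine whose deadline exceeded T.  At s no machine of deadline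
   at most T could receive the job, so the set A of these machines satisfies
   F_i(s) - L_i(s) < eps for all i in A, and |A| <= m - 1.  All jobs after s go
   to A, so that the sum of F_i - L_i over A does not grow up to T, whereas at T
   one of its terms exceeds delta and the others are at least -eps: hence
   delta < (2|A| - 1) eps <= (2m - 3) eps = delta.  If there is no such s, start
   from time 0, where all discrepancies vanish: delta < (m - 1) eps <= delta.
   Deadlines only increase, so that maintaining them costs O(mn) in total. *)

Require Import Defs.
From mathcomp Require Import all_boot all_order all_algebra.
From mathcomp Require Import reals.
From mathcomp Require Import zify ring lra.
Import Order.TTheory GRing.Theory Num.Theory.
Local Open Scope ring_scope.
Set Implicit Arguments.
Unset Strict Implicit.
Unset Printing Implicit Defensive.

(** * Earliest deadline first *)

Section EarliestDeadline.
Variables (R : realFieldType) (m n : nat) (w : nat -> R) (X : nat -> nat -> R).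
Variables (D delta : R).
Hypothesis m_gt1 : (1 < m)%N.
Hypothesis w_gt0 : forall j, (j < n)%N -> 0 < w j.
Hypothesis w_leD : forall j, (j < n)%N -> w j <= D.
Hypothesis X_ge0 : forall i j, 0 <= X i j.
Hypothesis X_sum : forall j, (j < n)%N -> \sum_(i < m) X i j = 1.
Hypothesis D_ge0 : 0 <= D.
Hypothesis deltaE : delta = (1 - 1 / (2 * m%:R - 2)) * D.

Definition frac_load (i t : nat) : R := \sum_(0 <= k < t) w k * X i k.

Definition load (c : nat -> nat) (i t : nat) : R :=
  \sum_(0 <= k < t) w k * (c k == i)%:R.

(** Rearranged, [frac_load i j.+1 - (load c i j + w j) >= - delta]: receiving job [j] keeps the
    lower discrepancy bound of [i]. *)
Definition eligible (c : nat -> nat) (j i : nat) : Prop :=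
  w j - delta <= frac_load i j.+1 - load c i j.

(** Earliest deadline first without naming deadlines: as [frac_load] is monotone in time, [c j] has
    a deadline no later than that of [i] when overflow of [i] at [T] forces overflow of [c j] at
    [T]. *)
Definition greedy (c : nat -> nat) (j : nat) : Prop :=
  [/\ (c j < m)%N, eligible c j (c j) &
      forall i T, (i < m)%N -> (T <= n)%N -> eligible c j i ->
        delta < frac_load i T - load c i j ->
        delta < frac_load (c j) T - load c (c j) j].

Lemma eq_load c c' i t :
  (forall k, (k < t)%N -> c k = c' k) -> load c i t = load c' i t.
Proof.
by move=> cc'; apply: eq_big_nat => k /andP[_ kt]; rewrite cc'.
Qed.

Lemma load0 c i : load c i 0 = 0.
Proof. exact: big_nil. Qed.

Lemma frac_load0 i : frac_load i 0 = 0.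
Proof. exact: big_nil. Qed.

Lemma loadS c i t : load c i t.+1 = load c i t + w t * (c t == i)%:R.
Proof. exact: big_nat_recr. Qed.

Lemma frac_loadS i t : frac_load i t.+1 = frac_load i t + w t * X i t.
Proof. exact: big_nat_recr. Qed.

Lemma load_sub c i u t : (u <= t)%N ->
  load c i t - load c i u = \sum_(u <= k < t) w k * (c k == i)%:R.
Proof.
by move=> ut; rewrite /load (@big_cat_nat _ _ _ u) //= addrAC subrr add0r.
Qed.

Lemma frac_load_sub i u t : (u <= t)%N ->
  frac_load i t - frac_load i u = \sum_(u <= k < t) w k * X i k.
Proof.
by move=> ut; rewrite /frac_load (@big_cat_nat _ _ _ u) //= addrAC subrr add0r.
Qed.

Lemma le_load c i u t : (u <= t <= n)%N -> load c i u <= load c i t.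
Proof.
move=> /andP[ut tn].
rewrite -subr_ge0 load_sub // big_nat_cond sumr_ge0 // => k.
rewrite andbT => /andP[_ kt].
by rewrite mulr_ge0 ?ler0n // ltW // w_gt0 // (leq_trans kt).
Qed.

Lemma le_frac_load i u t : (u <= t <= n)%N -> frac_load i u <= frac_load i t.
Proof.
move=> /andP[ut tn].
rewrite -subr_ge0 frac_load_sub // big_nat_cond sumr_ge0 // => k.
rewrite andbT => /andP[_ kt].
by rewrite mulr_ge0 // ltW // w_gt0 // (leq_trans kt).
Qed.

Lemma sum_frac_load_sub u t : (u <= t <= n)%N ->
  \sum_(i < m) (frac_load i t - frac_load i u) = \sum_(u <= k < t) w k.
Proof.
move=> /andP[ut tn].
under eq_bigr => i _ do rewrite frac_load_sub //.
rewrite exchange_big /=; apply: eq_big_nat => k /andP[_ kt].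
by rewrite -mulr_sumr X_sum ?mulr1 // (leq_trans kt).
Qed.

Lemma sum_load_sub (c : nat -> nat) (A : pred 'I_m) u t : (u <= t)%N ->
  (forall k, (u <= k < t)%N -> exists2 i : 'I_m, A i & c k = i :> nat) ->
  \sum_(i < m | A i) (load c i t - load c i u) = \sum_(u <= k < t) w k.
Proof.
move=> ut cA.
under eq_bigr => i _ do rewrite load_sub //.
rewrite exchange_big /=; apply: eq_big_nat => k kut.
have [i Ai cki] := cA k kut.
rewrite (bigD1 i) //= cki eqxx mulr1 big1 ?addr0 // => i' /andP[_ ii'].
by rewrite (_ : (i == i' :> nat) = false) ?mulr0 // eq_sym; apply: negbTE.
Qed.

Let eps : R := D - delta.

Let mR_ge2 : 2 <= m%:R :> R.
Proof. by rewrite ler_nat. Qed.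

Lemma D_eps : D = (2 * m%:R - 2) * eps.
Proof. by rewrite /eps deltaE; field; move: mR_ge2 => h; lra. Qed.

Lemma delta_eps : delta = (2 * m%:R - 3) * eps.
Proof.
have Deps : D = eps + delta by rewrite /eps; ring.
by have := D_eps; move: Deps; set e := eps; clearbody e => ->; lra.
Qed.

Lemma eps_ge0 : 0 <= eps.
Proof. by have := D_eps; have := mR_ge2; have := D_ge0; nra. Qed.

Lemma delta_ge0 : 0 <= delta.
Proof. by rewrite delta_eps mulr_ge0 ?eps_ge0 //; have := mR_ge2; lra. Qed.

(** Averaging: the values [frac_load i j.+1 - load c i j] sum to [w j]. Were all of them below
    [w j - delta], then [m * delta < (m - 1) * w j <= (m - 1) * D], that is
    [m * (2m - 3) * eps < 2 * (m - 1)^2 * eps], which fails for [m >= 2]. *)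
Lemma exists_eligible c j : (j < n)%N -> (forall k, (k < j)%N -> (c k < m)%N) ->
  exists2 i, (i < m)%N & eligible c j i.
Proof.
move=> jn cm.
suff /existsP[i Ei] :
    [exists i : 'I_m, w j - delta <= frac_load i j.+1 - load c i j].
  by exists (i : nat).
apply: contraT => /existsPn nE.
have sumE : \sum_(i < m) (frac_load i j.+1 - load c i j) = w j.
  transitivity (\sum_(i < m) ((frac_load i j.+1 - frac_load i 0)
                - (load c i j - load c i 0))).
    by apply: eq_bigr => i _; rewrite frac_load0 load0 !subr0.
  rewrite sumrB sum_frac_load_sub // (@sum_load_sub c xpredT) //; last first.
    by move=> k kj; exists (Ordinal (cm k kj)).
  by rewrite big_nat_recr //= addrAC subrr add0r.
have : \sum_(i < m) (frac_load i j.+1 - load c i j)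
    < \sum_(i < m) (w j - delta).
  apply: ltr_sum => [|i _]; last by rewrite ltNge nE.
  by apply/hasP; exists (Ordinal (ltnW m_gt1)); rewrite ?mem_index_enum.
rewrite sumE sumr_const card_ord -[_ *+ m]mulr_natl.
have := w_leD jn; have := w_gt0 jn; have := delta_eps; have := D_eps.
have := mR_ge2; have := eps_ge0; nra.
Qed.

Definition overflowing (c : nat -> nat) (u T : nat) : pred 'I_m :=
  [pred i : 'I_m | delta < frac_load i T - load c i u].

(* If from time [u] on every job goes to a machine that would otherwise overflow
   by time [T], then all of the work of [[u, T)] goes to the set of such
   machines, which therefore cannot gain on its fractional load. *)
Lemma overflow_sum c u T (i0 : 'I_m) :
  (u <= T <= n)%N ->
  (forall k, (u <= k < T)%N ->
     (c k < m)%N /\ delta < frac_load (c k) T - load c (c k) k) ->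
  delta < frac_load i0 T - load c i0 T ->
  delta < (#|overflowing c u T|%:R - 1) * eps
    + \sum_(i < m | overflowing c u T i) (frac_load i u - load c i u).
Proof.
move=> /andP[uT Tn] cT over; set A := overflowing c u T.
have Ai0 : A i0.
  by rewrite /A /overflowing /= (lt_le_trans over) // lerB // le_load // uT.
have cA k : (u <= k < T)%N -> exists2 i : 'I_m, A i & c k = i :> nat.
  move=> kuT; have [ckm ok] := cT k kuT; exists (Ordinal ckm) => //.
  by rewrite /A /overflowing /= (lt_le_trans ok) // lerB // le_load //; lia.
have low (i : 'I_m) : A i -> - eps <= frac_load i T - load c i T.
  move=> Ai.
  (* Induction on [t] from [u]: the value starts above [delta] and drops, by at most [D], only when
     it exceeds [delta], so it never falls below [delta - D = - eps]. *)
  suff lowt t : (u <= t <= T)%N -> - eps <= frac_load i T - load c i t.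
    by rewrite lowt // uT leqnn.
  elim: t => [|t IH] /andP[ut tT].
    move: Ai; rewrite /A /overflowing /=; have -> : u = 0%N by lia.
    by have := delta_ge0; have := eps_ge0; lra.
  have [ut'|ut'] := ltnP t u.
    have <- : u = t.+1 by lia.
    move: Ai; rewrite /A /overflowing /=.
    by have := delta_ge0; have := eps_ge0; lra.
  rewrite loadS; have [ct|_] := eqVneq (c t) i; last first.
    by rewrite mulr0 addr0 IH //; lia.
  have [_] := cT t ltac:(lia); rewrite ct mulr1.
  by have := @w_leD t ltac:(lia); rewrite /eps; lra.
have lower : delta - (#|A|%:R - 1) * eps
    < \sum_(i < m | A i) (frac_load i T - load c i T).
  rewrite (bigD1 i0) //=.
  have : \sum_(i < m | A i && (i != i0)) - eps
      <= \sum_(i < m | A i && (i != i0)) (frac_load i T - load c i T).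
    by apply: ler_sum => i /andP[Ai _]; apply: low.
  rewrite sumr_const.
  rewrite (cardD1 i0 A) (_ : i0 \in A = true); last exact: Ai0.
  rewrite natrD [1 + _]addrC addrK.
  rewrite (_ : #|_| = #|[predD1 A & i0]|); last first.
    by apply: eq_card => i; rewrite !inE andbC.
  by rewrite mulNrn -mulr_natl; move: over; lra.
(* Outside [A] fractional loads do not decrease, so the fractional gain of [A] is at most the total
   work of [[u, T)], which is the gain of the integral loads of [A]. *)
have : \sum_(i < m | A i) (frac_load i T - frac_load i u)
    <= \sum_(u <= k < T) w k.
  rewrite -sum_frac_load_sub ?uT // [leRHS](bigID A) /= lerDl.
  rewrite sumr_ge0 // => i _.
  by rewrite subr_ge0 le_frac_load // uT.
have := @sum_load_sub c A u T uT cA.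
move: lower; rewrite !sumrB; lra.
Qed.

Lemma greedy_discrepancy c : (forall j, (j < n)%N -> greedy c j) ->
  forall i t, (i < m)%N -> (t <= n)%N -> `|frac_load i t - load c i t| <= delta.
Proof.
move=> gc i t im tn; rewrite ler_norml; apply/andP; split.
  (* Lower bound: the discrepancy of [i] can decrease only when [i] receives a job, and eligibility
     is then the required bound. *)
  elim: t tn => [|t IH] tn.
    by rewrite frac_load0 load0 subr0 oppr_le0 delta_ge0.
  rewrite loadS; have [ct|_] := eqVneq (c t) i.
    have [_ + _] := gc t tn; rewrite /eligible ct mulr1; lra.
  rewrite mulr0 addr0 (le_trans (IH (ltnW tn))) // lerB //.
  by rewrite le_frac_load // leqnSn.
rewrite leNgt; apply/negP => over; pose i0 := Ordinal im.
(* [P s]: job [s] went to a machine whose deadline exceeds [t]. *)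
pose P s := (s < t)%N && (frac_load (c s) t - load c (c s) s <= delta).
have core u : (u <= t)%N -> (forall k, (u <= k < t)%N -> ~~ P k) ->
    delta < (#|overflowing c u t|%:R - 1) * eps
      + \sum_(i < m | overflowing c u t i) (frac_load i u - load c i u).
  move=> ut nP; apply: (@overflow_sum c u t i0) => //; first by rewrite ut.
  move=> k kut; have [ckm _ _] := gc k ltac:(lia); split=> //.
  by have := nP k kut; rewrite /P; case/andP: kut => _ -> /=; rewrite -ltNge.
have [/existsP[s0 Ps0]|nP] := boolP [exists s : 'I_t, P s]; last first.
  have nP0 k : (0 <= k < t)%N -> ~~ P k.
    by case/andP=> _ kt; have /existsPn/(_ (Ordinal kt)) := nP.
  have := core 0%N (leq0n _) nP0.
  rewrite /= big1 => [|i' _]; last by rewrite frac_load0 load0 subrr.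
  rewrite addr0; set A := overflowing c 0 t.
  have : #|A|%:R <= m%:R :> R by rewrite ler_nat -[leqRHS]card_ord max_card.
  by have := delta_eps; have := eps_ge0; have := mR_ge2; nra.
have exP : exists s, P s by exists s0.
have ubP s : P s -> (s <= t)%N by case/andP=> /ltnW.
have [s /andP[st sd] smax] := ex_maxnP exP ubP.
have [csm _ edf] := gc s ltac:(lia).
have nPs k : (s.+1 <= k < t)%N -> ~~ P k.
  by case/andP=> sk _; apply/negP => /smax; lia.
have := core s.+1 st nPs.
set A := overflowing c s.+1 t => /= /lt_geF/negP; apply.
(* The machine [c s] has a deadline beyond [t], so it lies outside [A]; this gives
   [#|A| <= m - 1]. *)
have csA : ~~ A (Ordinal csm).
  rewrite /A /overflowing /= -leNgt (le_trans _ sd) // lerB // le_load //; lia.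
have cardA : #|A|%:R <= m%:R - 1 :> R.
  rewrite lerBrDr natr1 ler_nat.
  suff cA : (0 < #|[predC A]|)%N.
    by move: (cardC A) cA; rewrite card_ord; set a := #|A|; set b := #|_|; lia.
  by apply/card_gt0P; exists (Ordinal csm).
have : \sum_(i < m | A i) (frac_load i s.+1 - load c i s.+1)
   <= \sum_(i < m | A i) eps.
  apply: ler_sum => i' Ai'.
  have csi : (c s == i') = false.
    apply: contraNF csA => /eqP csi; rewrite (_ : Ordinal csm = i') //.
    exact: val_inj.
  (* A discrepancy above [eps >= w s - delta] would make [i'] eligible for job [s]; as [i']
     overflows by [t], the choice of [c s] would make [c s] overflow too, against [P s]. *)
  rewrite leNgt; apply/negP => elig.
  have := edf i' t (ltn_ord i') tn; rewrite /eligible.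
  move: Ai' elig; rewrite /A /overflowing /= loadS csi mulr0 addr0 => Ai' elig.
  have := @w_leD s ltac:(lia); move: elig; rewrite /eps => elig ws.
  by move=> /(_ ltac:(lra) Ai'); rewrite ltNge sd.
rewrite sumr_const -[eps *+ _]mulr_natl.
have := delta_eps; have := eps_ge0; have := mR_ge2; move: cardA; nra.
Qed.

End EarliestDeadline.

(** * A program logic with budgets *)

Section Budget.
Variable R : realType.
Implicit Types (p q : cmd) (s : store R) (a : nat) (Q : store R -> nat -> Prop).

(* [a] is a budget of elementary operations, and [Q] also speaks about what is
   left of it: potential functions then become ordinary preconditions. *)
Definition runs p s a Q : Prop :=
  exists s' k, [/\ exec p s s' k, (k <= a)%N & Q s' (a - k)%N].

Lemma runs_weaken p s a Q Q' :
  runs p s a Q -> (forall s' a', Q s' a' -> Q' s' a') -> runs p s a Q'.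
Proof. by move=> [s' [k [ex ka Qs]]] QQ'; exists s', k; split; auto. Qed.

Lemma runs_skip s a Q : (0 < a)%N -> Q s (a - 1)%N -> runs Skip s a Q.
Proof. by move=> ? ?; exists s, 1%N; split=> //; constructor. Qed.

Lemma runs_setI s a b i j e Q : (icost i + icost j + icost e < a)%N ->
  Q (set_imem s b (ieval s i) (ieval s j) (ieval s e))
    (a - (icost i + icost j + icost e).+1)%N ->
  runs (SetI b i j e) s a Q.
Proof. by move=> ? ?; eexists; eexists; split; first by constructor. Qed.

Lemma runs_setR s a b i j e Q : (icost i + icost j + rcost e < a)%N ->
  Q (set_rmem s b (ieval s i) (ieval s j) (reval s e))
    (a - (icost i + icost j + rcost e).+1)%N ->
  runs (SetR b i j e) s a Q.
Proof. by move=> ? ?; eexists; eexists; split; first by constructor. Qed.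

Lemma runs_seq p q s a Q :
  runs p s a (fun s1 a1 => runs q s1 a1 Q) -> runs (Seq p q) s a Q.
Proof.
move=> [s1 [k [exp ka [s2 [l [exq la Qs]]]]]]; exists s2, (k + l)%N.
by split; [exact: ExecSeq exp exq | lia | rewrite subnDA].
Qed.

Lemma runs_if b p q s a Q : (bcost b < a)%N ->
  runs (if beval s b then p else q) s (a - (bcost b).+1)%N Q ->
  runs (If b p q) s a Q.
Proof.
move=> ba [s1 [k [ex ka Qs]]]; exists s1, (bcost b + k).+1.
split; [exact: ExecIf | lia |].
by rewrite (_ : (_ - _ = a - (bcost b).+1 - k)%N) //; lia.
Qed.

(* The budget decreases at each iteration, so that it serves as the variant. *)
Lemma runs_while b p Q (I : store R -> nat -> Prop) :
  (forall s a, I s a -> (bcost b < a)%N /\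
     if beval s b then runs p s (a - (bcost b).+1)%N I
     else Q s (a - (bcost b).+1)%N) ->
  forall s a, I s a -> runs (While b p) s a Q.
Proof.
move=> step s a; elim/ltn_ind: a s => a IH s /step[ba].
case: ifP => [bs [s1 [k [ex ka Is1]]]|bs Qs]; last first.
  by exists s, (bcost b).+1; split=> //; apply: ExecWhileDone; rewrite bs.
have [|s2 [l [exw la Qs]]] := IH _ _ s1 Is1; first by lia.
exists s2, (bcost b + k + l).+1; split; first exact: ExecWhileStep ex exw.
  by lia.
by rewrite (_ : (_ - _ = a - (bcost b).+1 - k - l)%N) //; lia.
Qed.

End Budget.

(** * The program *)

(* Naturals: array 0 holds m and n, array 1 the deadlines, and
   arrays 2, 3, 4 the job [jv], the machine [iv] and the selected machine [bv].
   Reals: arrays 0, 1, 2 are x, d and y, array 3 holds the fractional prefix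
   loads, array 4 the current loads, and array 5 the maximal weight, delta and
   the number m. *)
Local Notation c0 := (IConst 0).
Local Notation c1 := (IConst 1).
Definition mv : iexp := IGet 0 c0 c0.
Definition nv : iexp := IGet 0 c0 c1.
Definition jv : iexp := IGet 2 c0 c0.
Definition iv : iexp := IGet 3 c0 c0.
Definition bv : iexp := IGet 4 c0 c0.
Definition deadline (e : iexp) : iexp := IGet 1 e c0.
Definition weight : rexp := RGet 1 c0 jv.
Definition maxw : rexp := RGet 5 c0 c0.
Definition deltav : rexp := RGet 5 c0 c1.
Definition mreal : rexp := RGet 5 c0 (IConst 2).

Definition max_prog : cmd :=
  Seq (SetI 2 c0 c0 c0)
   (While (BLtI jv nv)
     (Seq (If (BLtR maxw weight) (SetR 5 c0 c0 weight) Skip)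
          (SetI 2 c0 c0 (IAdd jv c1)))).

Definition row_prog : cmd :=
  While (BLtI jv nv)
    (Seq (SetR 3 iv (IAdd jv c1)
            (RAdd (RGet 3 iv jv) (RMul weight (RGet 0 iv jv))))
         (SetI 2 c0 c0 (IAdd jv c1))).

(** The model cannot convert naturals to reals, so the real number [m] is obtained by adding 1 once
    per row. *)
Definition prefix_prog : cmd :=
  Seq (SetI 3 c0 c0 c0)
   (While (BLtI iv mv)
     (Seq (SetR 5 c0 (IConst 2) (RAdd mreal ROne))
     (Seq (SetI 2 c0 c0 c0)
     (Seq row_prog
          (SetI 3 c0 c0 (IAdd iv c1)))))).

(** The deadline cell is a pointer that only moves forward and is kept from one job to the next. *)
Definition advance_prog : cmd :=
  While (BAnd (BLtI (deadline iv) (IAdd nv c1))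
           (BNot (BLtR deltav
              (RSub (RGet 3 iv (deadline iv)) (RGet 4 iv c0)))))
    (SetI 1 iv c0 (IAdd (deadline iv) c1)).

Definition select_prog : cmd :=
  If (BAnd (BLtI (deadline iv) (deadline bv))
        (BNot (BLtR (RSub (RGet 3 iv (IAdd jv c1)) (RGet 4 iv c0))
                    (RSub weight deltav))))
     (SetI 4 c0 c0 iv) Skip.

Definition scan_prog : cmd :=
  While (BLtI iv mv)
    (Seq advance_prog (Seq select_prog (SetI 3 c0 c0 (IAdd iv c1)))).

Definition assign_prog : cmd :=
  Seq (SetI 2 c0 c0 c0)
   (While (BLtI jv nv)
     (Seq (SetI 4 c0 c0 mv)
     (Seq (SetI 3 c0 c0 c0)
     (Seq scan_prog
     (Seq (SetR 2 bv jv ROne)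
     (Seq (SetR 4 bv c0 (RAdd (RGet 4 bv c0) weight))
          (SetI 2 c0 c0 (IAdd jv c1)))))))).

Definition two : rexp := RAdd ROne ROne.

Definition delta_prog : cmd :=
  SetR 5 c0 c1
    (RMul (RSub ROne (RDiv ROne (RSub (RMul two mreal) two))) maxw).

(* The cell (m, 0) of the deadlines is a sentinel, larger than the value n + 1
   that stands for the absence of a deadline. *)
Definition carpool_prog : cmd :=
  Seq max_prog
  (Seq prefix_prog
  (Seq delta_prog
  (Seq (SetI 1 mv c0 (IAdd nv (IConst 2)))
       assign_prog))).

(** * Correctness and cost of the program: maximal weight and prefix loads *)

Section Correctness.
Variables (R : realType) (m n : nat) (w : nat -> R) (X : nat -> nat -> R).
Implicit Types (s : store R) (a rest : nat).

Local Notation F := (frac_load w X).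
Local Notation L := (load w).

Record inputs s : Prop := Inputs {
  inputs_m : imem s 0 0 0 = m;
  inputs_n : imem s 0 0 1 = n;
  inputs_x : forall i j, rmem s 0 i j = X i j;
  inputs_d : forall j, rmem s 1 0 j = w j }.

(** The universal property of a maximum: the upper bound feeds the greedy analysis, and leastness
    finally yields [D <= max_weight d]. *)
Definition max_upto (j : nat) (D : R) : Prop :=
  [/\ 0 <= D, forall k, (k < j)%N -> w k <= D &
      forall M, 0 <= M -> (forall k, (k < j)%N -> w k <= M) -> D <= M].

Lemma max_upto0 : max_upto 0 0.
Proof. by []. Qed.

Lemma max_uptoS j D : max_upto j D -> max_upto j.+1 (Num.max D (w j)).
Proof.
case=> D0 wD Dlub; split=> [|k|M M0 wM]; rewrite ?le_max ?ge_max ?D0 //.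
  by rewrite ltnS leq_eqVlt => /predU1P[->|/wD->]; rewrite ?lexx ?orbT.
by rewrite wM // Dlub // => k kj; rewrite wM // ltnW.
Qed.

Record fresh s : Prop := Fresh {
  fresh_y : forall i j, rmem s 2 i j = 0;
  fresh_load : forall i, rmem s 4 i 0 = 0;
  fresh_deadline : forall i, imem s 1 i 0 = 0%N }.

Lemma runs_max s a rest : inputs s -> fresh s ->
  (forall i, rmem s 3 i 0 = 0) -> rmem s 5 0 0 = 0 -> rmem s 5 0 2 = 0 ->
  (50 * n + 50 + rest <= a)%N ->
  runs max_prog s a (fun s' a' =>
    [/\ inputs s', fresh s', forall i, rmem s' 3 i 0 = 0, rmem s' 5 0 2 = 0
      & max_upto n (rmem s' 5 0 0)]
    /\ (rest <= a')%N).
Proof.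
move=> [sm sn sx sd] [sy sl sp] sF sD sM ha.
apply: runs_seq; apply: runs_setI => /=; first by lia.
apply: (@runs_while _ _ _ _ (fun s' a' =>
  [/\ inputs s', fresh s', forall i, rmem s' 3 i 0 = 0 & rmem s' 5 0 2 = 0]
  /\ exists j, [/\ imem s' 2 0 0 = j, (j <= n)%N,
       max_upto j (rmem s' 5 0 0)
     & (50 * (n - j) + 10 + rest <= a')%N])); last first.
  split; first by [].
  by exists 0%N; split=> //=; [rewrite sD; exact: max_upto0 | lia].
move=> {s a sm sn sx sd sy sl sp sF sD sM ha}.
move=> s a [[[sm sn sx sd] [sy sl sp] sF sM] [j [sj jn sD ha]]] /=.
split; first by lia.
rewrite sj sn; case: ltnP => jn'; last first.
  have jE : j = n by lia.
  by split; [split=> //; rewrite -jE | lia].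
have maxS := max_uptoS sD.
apply: runs_seq; apply: runs_if => /=; first by lia.
rewrite sj; case: ltP => cmp.
  apply: runs_setR => /=; first by lia.
  apply: runs_setI => /=; first by lia.
  split; first by [].
  exists j.+1; rewrite /upd /= sj addn1; split=> //; last by lia.
  by rewrite sd; move: maxS; rewrite max_r // ltW // -sd.
apply: runs_skip; first by lia.
apply: runs_setI => /=; first by lia.
split; first by [].
exists j.+1; rewrite /upd /= sj addn1; split=> //; last by lia.
by move: maxS; rewrite max_l // -sd.
Qed.

Lemma runs_row s a rest i : inputs s -> fresh s ->
  imem s 3 0 0 = i -> imem s 2 0 0 = 0%N -> rmem s 3 i 0 = 0 ->
  (50 * n + 10 + rest <= a)%N ->
  runs row_prog s a (fun s' a' =>
    [/\ inputs s', fresh s', imem s' 3 0 0 = i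
      & forall j, rmem s' 5 0 j = rmem s 5 0 j]
    /\ [/\ forall i' t, i' != i -> rmem s' 3 i' t = rmem s 3 i' t,
          forall t, (t <= n)%N -> rmem s' 3 i t = F i t
        & (rest <= a')%N]).
Proof.
move=> is_ fs si sj sF ha.
apply: (@runs_while _ _ _ _ (fun s' a' =>
  [/\ inputs s', fresh s', imem s' 3 0 0 = i
    & forall j, rmem s' 5 0 j = rmem s 5 0 j]
  /\ exists j, [/\ imem s' 2 0 0 = j, (j <= n)%N,
       forall i' t, i' != i -> rmem s' 3 i' t = rmem s 3 i' t,
       forall t, (t <= j)%N -> rmem s' 3 i t = F i t
     & (50 * (n - j) + 10 + rest <= a')%N])); last first.
  split; first by split.
  exists 0%N; split=> //; last by lia.
  move=> t.
  by rewrite leqn0 => /eqP->; rewrite frac_load0.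
move: s sj sF a is_ fs si ha => s0 _ _ _ _ _ _ _ s a.
case=> [[[sm sn sx sd] [sy sl sp] si s5] [j [sj jn sF' sF ha]]] /=.
split; first by lia.
rewrite sj sn; case: ltnP => jn'; last first.
  have jE : j = n by lia.
  split; first by split.
  by split; [exact: sF' | rewrite -jE; exact: sF | lia].
apply: runs_seq; apply: runs_setR => /=; first by lia.
apply: runs_setI => /=; first by lia.
split; first by [].
exists j.+1; rewrite /upd /= sj si addn1; split=> //; last by lia.
  by move=> i' t i'i; rewrite (negbTE i'i) /= sF'.
move=> t tj; rewrite eqxx /=; case: eqP => [->|/eqP tj'].
  by rewrite frac_loadS sF // sd sx.
by rewrite sF //; lia.
Qed.

Lemma runs_prefix s a rest : inputs s -> fresh s ->
  (forall i, rmem s 3 i 0 = 0) -> rmem s 5 0 2 = 0 ->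
  (m * (50 * n + 50) + 50 + rest <= a)%N ->
  runs prefix_prog s a (fun s' a' =>
    [/\ inputs s', fresh s', rmem s' 5 0 0 = rmem s 5 0 0,
        rmem s' 5 0 2 = m%:R
      & forall i t, (i < m)%N -> (t <= n)%N -> rmem s' 3 i t = F i t]
    /\ (rest <= a')%N).
Proof.
move=> [sm sn sx sd] [sy sl sp] sF sM ha.
apply: runs_seq; apply: runs_setI => /=; first by lia.
apply: (@runs_while _ _ _ _ (fun s' a' =>
  [/\ inputs s', fresh s', rmem s' 5 0 0 = rmem s 5 0 0
    & forall i, rmem s' 3 i 0 = 0]
  /\ exists i, [/\ imem s' 3 0 0 = i, (i <= m)%N, rmem s' 5 0 2 = i%:R,
       forall i' t, (i' < i)%N -> (t <= n)%N -> rmem s' 3 i' t = F i' t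
     & ((m - i) * (50 * n + 50) + 10 + rest <= a')%N])); last first.
  by split=> //; exists 0%N; split=> //=; lia.
move: s a sm sn sx sd sy sl sp sF sM ha => s0 _ _ _ _ _ _ _ _ _ _ _ s a.
case=> [[[sm sn sx sd] [sy sl sp] sD s3] [i [si im sM sF ha]]] /=.
have ha' : (10 + rest <= a)%N by apply: leq_trans ha; rewrite -addnA leq_addl.
split; first by lia.
rewrite si sm; case: ltnP => im'; last first.
  have iE : i = m by lia.
  by rewrite iE in sM sF; split=> //; lia.
(* The nonlinear product is hidden behind [K] so that [lia] can treat it as an atom. *)
have [K KE] : exists K, K = ((m - i.+1) * (50 * n + 50))%N by eexists.
have mi : (m - i = (m - i.+1).+1)%N by lia.
rewrite mi mulSn -KE in ha.
apply: runs_seq; apply: runs_setR => /=; first by lia.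
apply: runs_seq; apply: runs_setI => /=; first by lia.
apply: runs_seq.
apply: (runs_weaken (@runs_row _ _
(K + 10 + 10 + rest) i _ _ _ _ _ _)) => //=.
- by rewrite /upd /= s3.
- by lia.
move=> {ha ha'} s' a' [[[sm' sn' sx' sd'] [sy' sl' sp'] si' s5] [sF' sFi ha']].
apply: runs_setI => /=; first by lia.
split; first split=> //=; first by rewrite s5.
  move=> i'; rewrite /upd /=; have [->|ne] := eqVneq i' i.
    by rewrite sFi // frac_load0.
  by rewrite sF' // /upd /= s3.
exists i.+1; rewrite /upd /= si' addn1 -KE; split=> //; last by lia.
  by rewrite s5 /upd /= sM natr1.
move=> i' t i'i tn; have [->|ne] := eqVneq i' i; first exact: sFi.
by rewrite sF' // /upd /= sF //; lia.
Qed.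

(** * The main loop: scanning the machines and assigning the jobs *)

Variable delta : R.
Hypothesis w_ge0 : forall j, (j < n)%N -> 0 <= w j.
Hypothesis le_F : forall i u t, (u <= t <= n)%N -> F i u <= F i t.
Hypothesis ex_eligible : forall c j, (j < n)%N ->
  (forall k, (k < j)%N -> (c k < m)%N) ->
  exists2 i, (i < m)%N & eligible w X delta c j i.

(** Here [c] is a ghost variable recording the choices made so far. By [assigned_ontime] the stored
    pointers are only lower bounds on the true deadlines. *)
Record assigned c j s : Prop := Assigned {
  assigned_inputs : inputs s;
  assigned_F : forall i t, (i < m)%N -> (t <= n)%N -> rmem s 3 i t = F i t;
  assigned_delta : rmem s 5 0 1 = delta;
  assigned_sentinel : imem s 1 m 0 = n.+2;
  assigned_greedy : forall k, (k < j)%N -> greedy m n w X delta c k;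
  assigned_y : forall i k, rmem s 2 i k = ((k < j)%N && (c k == i))%:R;
  assigned_load : forall i, rmem s 4 i 0 = L c i j;
  assigned_deadline : forall i, (i < m)%N -> (imem s 1 i 0 <= n.+1)%N;
  assigned_ontime : forall i T, (i < m)%N -> (T < imem s 1 i 0)%N ->
    F i T - L c i j <= delta }.

(** For the machines already scanned, [scanned_late] makes the pointers exact. The value [m] in the
    selection cell means that no candidate has been found yet. *)
Record scanned c j i s : Prop := Scanned {
  scanned_assigned : assigned c j s;
  scanned_j : imem s 2 0 0 = j;
  scanned_i : imem s 3 0 0 = i;
  scanned_late : forall i', (i' < i)%N -> (imem s 1 i' 0 <= n)%N ->
    delta < F i' (imem s 1 i' 0) - L c i' j;
  scanned_best : imem s 4 0 0 = m \/
    (imem s 4 0 0 < i)%N /\ eligible w X delta c j (imem s 4 0 0);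
  scanned_opt : forall i', (i' < i)%N -> eligible w X delta c j i' ->
    (imem s 1 (imem s 4 0 0) 0 <= imem s 1 i' 0)%N }.

(* Each step of a deadline is paid for by this potential, which makes the cost
   of all scans together linear in mn. *)
Definition slack s : nat := \sum_(i < m) (n.+1 - imem s 1 i 0).

Lemma slack_incr s i : (i < m)%N -> (imem s 1 i 0 <= n)%N ->
  slack s = (slack (set_imem s 1 i 0 (imem s 1 i 0 + 1))).+1.
Proof.
move=> im pn; rewrite /slack (bigD1 (Ordinal im)) //=.
rewrite [in RHS](bigD1 (Ordinal im)) //=.
rewrite /upd !eqxx /= subSn // addn1 subSS addSn; congr (_ + _).+1.
by apply: eq_bigr => k /negbTE; rewrite -val_eqE /= => ->.
Qed.

Lemma runs_advance c j i s a rest : scanned c j i s -> (i < m)%N ->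
  (50 * slack s + 40 + rest <= a)%N ->
  runs advance_prog s a (fun s' a' =>
    [/\ scanned c j i s',
        (imem s' 1 i 0 <= n)%N -> delta < F i (imem s' 1 i 0) - L c i j
      & (50 * slack s' + rest <= a')%N]).
Proof.
move=> sc im ha.
apply: (@runs_while _ _ _ _ (fun s' a' =>
  scanned c j i s' /\ (50 * slack s' + 40 + rest <= a')%N)) => //.
move: s a sc ha => _ _ _ _ s a [sc ha] /=.
split; first by lia.
case: (sc) => [[[sm sn sx sd] sF sD sS sG sY sL dle ont] sj si late best opt].
rewrite si sn sD sL /= addn1 ltnS.
have exact_exit : ~~ ((imem s 1 i 0 <= n)%N &&
    ~~ (delta < rmem s 3 i (imem s 1 i 0) - L c i j)) ->
    (imem s 1 i 0 <= n)%N -> delta < F i (imem s 1 i 0) - L c i j.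
  by move=> + pn; rewrite pn sF // negbK.
case: ifP => [|/negbT/exact_exit late_i]; last by split=> //; lia.
case/andP=> pn; rewrite sF // -leNgt => Fp.
have slackE := slack_incr im pn.
apply: runs_setI => /=; first by lia.
rewrite si; split; last by lia.
have ni i' : (i' < i)%N -> (i' == i) = false by lia.
split=> //=.
- split=> //= [|i' i'm|i' T i'm]; rewrite /upd /=.
  + by rewrite (_ : (m == i) = false) //; lia.
  + by case: eqP => _ /=; [lia | exact: dle].
  + case: eqP => [->|_] /=; last exact: ont.
    rewrite addn1 ltnS leq_eqVlt => /predU1P[->//|]; exact: ont.
- by move=> i' i'i; rewrite /upd /= (ni _ i'i) /=; exact: late.
- move=> i' i'i el; rewrite /upd /= (ni _ i'i) /=.
  (* The selected machine is [m] or precedes [i], so moving the pointer of [i] leaves its deadline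
     unchanged. *)
  have bi : (imem s 4 0 0 == i) = false by case: best => [->|[]]; lia.
  by rewrite bi; exact: opt.
Qed.

Lemma runs_scan c j s a rest : scanned c j 0 s -> (j < n)%N ->
  (50 * slack s + 150 * m + 20 + rest <= a)%N ->
  runs scan_prog s a (fun s' a' =>
    scanned c j m s' /\ (50 * slack s' + rest <= a')%N).
Proof.
move=> sc jn ha.
apply: (@runs_while _ _ _ _ (fun s' a' => exists i, [/\ scanned c j i s',
  (i <= m)%N & (50 * slack s' + 150 * (m - i) + 20 + rest <= a')%N]));
  last first.
  by exists 0%N; rewrite subn0.
move: s a sc ha => _ _ _ _ s a [i [sc im ha]] /=.
split; first by lia.
have [[[sm _ _ _] _ _ _ _ _ _ _ _] _ si _ _ _] := sc.
rewrite si sm; case: ltnP => im'; last first.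
  have iE : i = m by lia.
  by rewrite iE in sc; split=> //; lia.
apply: runs_seq.
apply: (runs_weaken (@runs_advance c j i s _
  (150 * (m - i.+1) + 20 + 80 + rest) sc im' _)).
  by lia.
move: s a sc ha sm si => _ _ _ _ _ _ s a [sc late_i ha].
have [[[sm sn sx sd] sF sD sS sG sY sL dle ont] sj si late best opt] := sc.
apply: runs_seq; apply: runs_if => /=; first by lia.
rewrite si sj !sL sD sd addn1 sF // -leNgt.
have late' i' : (i' < i.+1)%N -> (imem s 1 i' 0 <= n)%N ->
    delta < F i' (imem s 1 i' 0) - L c i' j.
  by rewrite ltnS leq_eqVlt => /predU1P[->|/late].
case: ifP => [/andP[lt_i el_i]|no].
  apply: runs_setI => /=; first by lia.
  apply: runs_setI => /=; first by lia.
  exists i.+1; split=> //; last by rewrite (_ : slack _ = slack s) //; lia.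
  split=> //=; rewrite /upd /= ?si ?addn1 //.
    by right; split.
  move=> i'; rewrite ltnS leq_eqVlt => /predU1P[->//|i'i /(opt _ i'i)].
  exact/leq_trans/ltnW.
apply: runs_skip; first by lia.
apply: runs_setI => /=; first by lia.
exists i.+1; split=> //; last by rewrite (_ : slack _ = slack s) //; lia.
split=> //=; rewrite /upd /= ?si ?addn1 //.
  by case: best => [->|[bi el]]; [left | right; split=> //; lia].
move=> i'; rewrite ltnS leq_eqVlt => /predU1P[->|i'i]; last exact: opt.
by move=> el; move: no; rewrite /eligible in el; rewrite el andbT; lia.
Qed.

(** Some machine is eligible and its pointer is below the sentinel [n.+2], so a real machine is
    selected. If an eligible machine overflows at [T], its pointer is at most [T], hence so is the
    selected one, where overflow is known; monotonicity of [F] carries it to [T]. The form with [c']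
    allows the history to be extended at [j] afterwards. *)
Lemma scanned_greedy c j s : (j < n)%N -> scanned c j m s ->
  (imem s 4 0 0 < m)%N /\
  forall c', (forall k, (k < j)%N -> c' k = c k) -> c' j = imem s 4 0 0 ->
    greedy m n w X delta c' j.
Proof.
move=> jn [[[sm sn sx sd] sF sD sS sG sY sL dle ont] sj si late best opt].
have cm k : (k < j)%N -> (c k < m)%N by case/sG.
have [i im eli] := ex_eligible jn cm.
have [bm elb] : (imem s 4 0 0 < m)%N /\ eligible w X delta c j (imem s 4 0 0).
  case: best => // bm; have := opt i im eli; rewrite bm sS.
  by have := dle i im; lia.
split=> // c' cc' c'j.
have LE i' : L c' i' j = L c i' j by apply: eq_load.
split; rewrite ?c'j // /eligible ?LE // => i' T i'm Tn.
rewrite !LE => eli' late_i'.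
have dT : (imem s 1 i' 0 <= T)%N.
  by rewrite leqNgt; apply/negP => /(ont _ _ i'm); rewrite leNgt late_i'.
have bT := leq_trans (opt _ i'm eli') dT.
apply: lt_le_trans (late _ bm (leq_trans bT Tn)) _.
by rewrite lerB // le_F // bT.
Qed.

Lemma runs_assign s a rest c : assigned c 0 s ->
  (50 * slack s + n * (150 * m + 150) + 50 + rest <= a)%N ->
  runs assign_prog s a (fun s' a' =>
    (exists c', assigned c' n s') /\ (rest <= a')%N).
Proof.
move=> as_ ha.
apply: runs_seq; apply: runs_setI => /=; first by lia.
apply: (@runs_while _ _ _ _ (fun s' a' => exists c j, [/\ assigned c j s',
  imem s' 2 0 0 = j, (j <= n)%N
  & (50 * slack s' + (n - j) * (150 * m + 150) + 20 + rest <= a')%N]));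
  last first.
  exists c, 0%N; split=> //; last by rewrite (_ : slack _ = slack s) //; lia.
  by case: as_ => -[sm sn sx sd] sF sD sS sG sY sL dle ont.
move: c s a as_ ha => _ _ _ _ _ s a [c [j [as_ sj jn ha]]] /=.
have ha' : (20 + rest <= a)%N by apply: leq_trans ha; rewrite -addnA leq_addl.
split; first by lia.
case: (as_) => [[sm sn sx sd] sF sD sS sG sY sL dle ont].
rewrite sj sn; case: ltnP => jn'; last first.
  have jE : j = n by lia.
  by rewrite jE in as_; split; [exists c | lia].
have [K KE] : exists K, K = ((n - j.+1) * (150 * m + 150))%N by eexists.
have nj : (n - j = (n - j.+1).+1)%N by lia.
rewrite nj [(_.+1 * (_ + _))%N]mulSn -KE in ha.
apply: runs_seq; apply: runs_setI => /=; first by lia.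
apply: runs_seq; apply: runs_setI => /=; first by lia.
apply: runs_seq.
apply: (runs_weaken (@runs_scan c j _ _ (K + 80 + rest) _ jn' _)).
- by split=> //=; left; rewrite /upd /= sm.
- by rewrite (_ : slack _ = slack s) //; lia.
move=> {}s {ha ha' sm sn sx sd sF sD sS sG sY sL dle ont sj as_} {}a [sc ha].
have [bm gr] := scanned_greedy jn' sc.
have [[[sm sn sx sd] sF sD sS sG sY sL dle ont] sj si late best opt] := sc.
apply: runs_seq; apply: runs_setR => /=; first by lia.
apply: runs_seq; apply: runs_setR => /=; first by lia.
apply: runs_setI => /=; first by lia.
set b := imem s 4 0 0 in bm gr *.
(* The ghost history is extended by the machine just selected. *)
pose c' k := if k == j then b else c k.
have cc' k : (k < j)%N -> c' k = c k.
  by move=> kj; rewrite /c' (_ : (k == j) = false) //; lia.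
have c'j : c' j = b by rewrite /c' eqxx.
have LE i : L c' i j = L c i j by apply: eq_load.
exists c', j.+1; rewrite /upd /= sj addn1 -KE; split=> //; last first.
  by rewrite (_ : slack _ = slack s) //; lia.
split=> //=; rewrite /upd /=.
(* Earlier greedy choices persist, since they depend only on loads before [j]. *)
- move=> k; rewrite ltnS leq_eqVlt => /predU1P[->|kj]; first exact: gr.
  have [ck elk edf] := sG k kj.
  have LkE i : L c' i k = L c i k.
    by apply: eq_load => l lk; rewrite cc' //; lia.
  split; rewrite ?cc' // /eligible ?LkE // => i T; rewrite !LkE; exact: edf.
- move=> i k; have [->|kj] := eqVneq k j.
    by rewrite ltnSn c'j andbT eq_sym; case: eqP => //; rewrite sY ltnn.
  by rewrite andbF sY /c' (negbTE kj) ltnS [(k <= j)%N]leq_eqVlt (negbTE kj).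
- move=> i; rewrite andbT loadS LE c'j eq_sym; have [<-|_] := eqVneq i b.
    by rewrite sL sd mulr1.
  by rewrite sL mulr0 addr0.
(* Loads only grow, so the old pointers remain lower bounds on the deadlines. *)
- move=> i T im /(ont _ _ im); apply: le_trans.
  by rewrite lerB // loadS LE lerDl mulr_ge0 ?ler0n ?w_ge0.
Qed.

End Correctness.

(** * Passage from matrices to total functions, and assembly of the phases *)

Lemma entry_ord (R : realType) m n (A : 'M[R]_(m, n)) (i : 'I_m) (j : 'I_n) :
  entry A i j = A i j.
Proof. by rewrite /entry !valK. Qed.

Lemma entry_ge0 (R : realType) m n (A : 'M[R]_(m, n)) (i j : nat) :
  (forall i j, 0 <= A i j) -> 0 <= entry A i j.
Proof.
by move=> A0; rewrite /entry; case: insub => // i'; case: insub.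
Qed.

Theorem theorem1 (R : realType) :
  exists (p : cmd) (c : nat),
  forall (m n : nat) (x : 'M[R]_(m, n)) (d : 'rV[R]_n),
    (1 < m)%N -> (0 < n)%N ->
    fractional_assignment x -> (forall j : 'I_n, 0 < d 0 j) ->
    exists (s : store R) (k : nat),
      exec p (input_store x d) s k /\
      (k <= c * (m * n))%N /\
      assignment (output m n s) /\
      forall (i : 'I_m) (t : nat), (1 <= t <= n)%N ->
        `| \sum_(j < n | (j < t)%N) d 0 j * (x i j - output m n s i j) |
          <= (1 - 1 / (2 * m%:R - 2)) * max_weight d.
Proof.
(* In units of [m * n], the budget 1000 is split into 100 for the maximum, 200 for the prefix loads
   and 700 for the rest. *)
exists carpool_prog, 1000%N => m n x d m_gt1 n_gt0 [x01 xsum] d_gt0.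
pose w := entry d 0; pose X := entry x.
have wE (j : 'I_n) : w j = d 0 j by rewrite -entry_ord.
have w_gt0 j : (j < n)%N -> 0 < w j by move=> jn; rewrite (wE (Ordinal jn)).
have w_ge0 j jn := ltW (w_gt0 j jn).
have X_ge0 i j : 0 <= X i j.
  by apply: entry_ge0 => i' j'; case/andP: (x01 i' j').
have X_sum j : (j < n)%N -> \sum_(i < m) X i j = 1.
  move=> jn; rewrite -(xsum (Ordinal jn)); apply: eq_bigr => i _.
  by rewrite /X -entry_ord.
suff [s [k [ex kle [D [c [[D0 wD Dlub] as_]]]]]] : runs carpool_prog
    (input_store x d) (1000 * (m * n)) (fun s a => exists D c, max_upto w n D /\
      assigned m n w X ((1 - 1 / (2 * m%:R - 2)) * D) c n s).
  exists s, k; split=> //; split=> //.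
  have outE (i : 'I_m) (j : 'I_n) : output m n s i j = (c j == i)%:R.
    by rewrite mxE (assigned_y as_) ltn_ord.
  have gr := assigned_greedy as_.
  split; first split=> [i j|j].
  - by rewrite outE; case: eqP => _; [right | left].
  - have [cm _ _] := gr j (ltn_ord j).
    rewrite (bigD1 (Ordinal cm)) //= outE eqxx big1 ?addr0 // => i.
    by rewrite outE -val_eqE /= eq_sym => /negbTE->.
  move=> i t /andP[_ tn].
  have mR : 2 <= m%:R :> R by rewrite ler_nat.
  have Dmax : D <= max_weight d.
    apply: Dlub => [|k' k'n]; first exact: bigmax_ge_id.
    by rewrite (wE (Ordinal k'n)); exact: (le_bigmax _ (d 0)).
  (* The analysis gives the bound with the computed [D]; it passes to [max_weight d] because the
     factor is nonnegative, [2m - 2] being at least 2. *)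
  apply: (@le_trans _ _ ((1 - 1 / (2 * m%:R - 2)) * D)); last first.
    apply: ler_wpM2l => //; rewrite subr_ge0 ler_pdivrMr; lra.
  have := greedy_discrepancy m_gt1 w_gt0 wD X_ge0 X_sum D0 erefl gr
    (ltn_ord i) tn.
  congr (`|_| <= _); rewrite /frac_load /load -sumrB.
  rewrite (big_nat_widen _ _ _ _ _ tn) /= big_mkord; apply: eq_big => // j jt.
  by rewrite outE wE -mulrBr /X entry_ord.
have mn : (m <= m * n)%N by rewrite leq_pmulr.
have nm : (n <= m * n)%N by rewrite leq_pmull // ltnW.
have inp : inputs m n w X (input_store x d) by [].
have fr : fresh (input_store x d) by [].
apply: runs_seq.
apply: (runs_weaken (@runs_max _ m n w X _ _ (900 * (m * n))
  inp fr _ _ _ _)) => //.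
  by lia.
move=> {inp fr} s a [[inp fr s3 sM sD] ha].
apply: runs_seq.
apply: (runs_weaken (@runs_prefix _ m n w X _ _ (700 * (m * n))
  inp fr s3 sM _)).
  by lia.
move: sD => + {s3 sM ha}; move: s {inp fr a} => s0.
set D := rmem s0 5 0 0 => sD.
move=> s a [[[sm sn sx sd] [sy sl sp] sD' sM sF] ha].
pose delta := (1 - 1 / (2 * m%:R - 2)) * D.
have wD j : (j < n)%N -> w j <= D by case: sD => _ + _; apply.
have D0 : 0 <= D by case: sD.
apply: runs_seq; apply: runs_setR => /=; first by lia.
apply: runs_seq; apply: runs_setI => /=; first by lia.
(* At time 0 no job has been assigned, so a constant function serves as the history. *)
apply: (runs_weaken (@runs_assign _ m n w X delta _ _ _ _ _ 0 (fun=> 0%N) _ _)).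
- exact: w_ge0.
- by move=> i u t; exact: le_frac_load.
- by move=> c j; exact: (exists_eligible m_gt1 w_gt0 wD X_sum D0 erefl).
- split=> //=; rewrite /upd /=.
  + by rewrite sD' sM.
  + by rewrite sm eqxx sn addn2.
  + by move=> i; rewrite load0.
  + by move=> i im; rewrite sm (ltn_eqF im) /= sp.
  + by move=> i T im; rewrite sm (ltn_eqF im) /= sp.
(* All pointers start at 0, so the initial potential is [m * n.+1], which is linear in [m * n]. *)
- rewrite (_ : slack _ _ _ = (m * n.+1)%N); first by rewrite mulnS; nia.
  rewrite /slack (eq_bigr (fun=> n.+1)) ?sum_nat_const ?card_ord // => i _.
  by rewrite /= /upd /= sm (ltn_eqF (ltn_ord i)) /= sp subn0.
- by move=> s' a' [[c as_] _]; exists D, c.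
Qed.
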